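(* Let $(S,\mathcal{A},\mu)$ be a complete, $\sigma$-finite measure space. If $E$ is a uniformly smooth (US) Köthe function space over $(S,\mathcal{A},\mu)$ and $X$ is a uacs Banach space, then $E(X)$ is also uacs.
   Context: All Banach spaces are real. For a Banach space $X$, $X^*$ denotes its dual, $B_X$ its closed unit ball and $S_X$ its unit sphere. A Banach space $X$ is called: - US (uniformly smooth) if $\lim_{\tau\to0}\rho_X(\tau)/\tau=0$, where $\rho_X(\tau)=\sup\{\frac12(\|x+\tau y\|+\|x-\tau y\|-2):x,y\in S_X\}$ for $\tau>0$; - uacs (uniformly alternatively convex or smooth) if for all sequences $(x_n)$, $(y_n)$ in $S_X$ and $(x_n^* )$ in $S_{X^*}$: $\|x_n+y_n\|\to2$ and $x_n^*(x_n)\to1$ imply $x_n^*(y_n)\to1$. A Köthe function space over a complete, $\sigma$-finite measure space $(S,\mathcal{A},\mu)$ is a Banach space $(E,\|\cdot\|_E)$ of real-valued measurable functions on $S$ modulo equality $\mu$-a.e. such that: (i) $\chi_A\in E$ for every $A\in\mathcal{A}$ with $\mu(A)<\infty$; (ii) every $f\in E$ is $\mu$-integrable over every $A\in\mathcal{A}$ with $\mu(A)<\infty$; (iii) if $g$ is measurable and $f\in E$ with $|g(t)|\le|f(t)|$ $\mu$-a.e., then $g\in E$ and $\|g\|_E\le\|f\|_E$. For a Köthe function space $E$ and a Banach space $X$, the Köthe-Bochner space $E(X)$ is the Banach space of all Bochner-measurable functions $f:S\to X$ (modulo equality a.e.) with $\|f(\cdot)\|\in E$, normed by $\|f\|_{E(X)}=\|\,\|f(\cdot)\|\,\|_E$;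 Bochner-measurable means being the $\mu$-a.e. norm limit of a sequence of simple functions. *)

(* Defs.v *)
From HB Require Import structures.
From mathcomp Require Import all_boot all_order all_algebra.
From mathcomp Require Import generic_quotient ring_quotient.
From mathcomp Require Import all_classical all_reals all_analysis.
From mathcomp Require Import measurable_realfun.

Set Implicit Arguments.
Unset Strict Implicit.
Unset Printing Implicit Defensive.

Import Order.TTheory GRing.Theory Num.Theory.
Import numFieldNormedType.Exports.

Local Open Scope classical_set_scope.
Local Open Scope ring_scope.

Section BanachSpaceProperties.
Context {R : realType}.
Implicit Type V : normedModType R.

Definition unit_sphere V : set V := [set x | `|x| = 1].

Definition unit_ball V : set V := [set x | `|x| <= 1].

(* The supremum is over a bounded set when [phi] is continuous; [sup] returns
   the junk value 0 on unbounded sets, so continuity is a separate requirement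
   in [dual_unit_sphere]. *)
Definition dual_norm V (phi : V -> R) : R :=
  sup [set `|phi x| | x in @unit_ball V].

Definition dual_unit_sphere V : set {linear V -> R^o} :=
  [set phi | continuous phi /\ dual_norm phi = 1].

Definition modulus_of_smoothness V (tau : R) : R :=
  sup [set 2^-1 * (`|x + tau *: y| + `|x - tau *: y| - 2)
      | x in @unit_sphere V & y in @unit_sphere V].

Definition US V : Prop :=
  modulus_of_smoothness V tau / tau @[tau --> 0^'+] --> (0 : R).

Definition uacs V : Prop :=
  forall (x y : nat -> V) (phi : nat -> {linear V -> R^o}),
    (forall n, unit_sphere (x n)) -> (forall n, unit_sphere (y n)) ->
    (forall n, dual_unit_sphere (phi n)) ->
    `|x n + y n| @[n --> \oo] --> (2 : R) ->
    (phi n (x n) : R) @[n --> \oo] --> (1 : R) ->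
    (phi n (y n) : R) @[n --> \oo] --> (1 : R).

End BanachSpaceProperties.

(* The elements of [E] stand for classes of measurable functions modulo
   a.e. equality: [kfun] picks a representative of each class, so it embeds [E]
   linearly into the space of measurable functions modulo a.e. equality. *)
Record kotheSpace d (S : measurableType d) (R : realType)
    (mu : {measure set S -> \bar R}) := KotheSpace {
  kothe_sort :> completeNormedModType R ;
  kfun : kothe_sort -> {mfun S >-> R} ;
  kfun_linear : forall (a : R) (f g : kothe_sort),
    kfun (a *: f + g) = (fun t => a * kfun f t + kfun g t) %[ae mu] ;
  kfun_inj : forall f g : kothe_sort, kfun f = kfun g %[ae mu] -> f = g ;
  kfun_indic : forall A : set S, measurable A -> (mu A < +oo)%E ->
    exists f : kothe_sort, kfun f = \1_A %[ae mu] ;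
  kfun_integrable : forall (f : kothe_sort) (A : set S),
    measurable A -> (mu A < +oo)%E -> mu.-integrable A (EFin \o kfun f) ;
  kfun_ideal : forall (f : kothe_sort) (g : S -> R),
    measurable_fun setT g -> (\forall t \ae mu, `|g t| <= `|kfun f t|) ->
    exists2 h : kothe_sort, kfun h = g %[ae mu] & `|h| <= `|f|
}.

Section BochnerMeasurable.
Context d (S : measurableType d) (R : realType)
  (mu : {measure set S -> \bar R}) (X : normedModType R).

(* [{sfun S >-> _}] only covers functions with values in a [realType]. *)
Definition simple_fun (s : S -> X) : Prop :=
  finite_set (range s) /\ forall x, measurable (s @^-1` [set x]).

Definition bochner_measurable (f : S -> X) : Prop :=
  exists2 s : nat -> S -> X, forall n, simple_fun (s n) &
    \forall t \ae mu, s n t @[n --> \oo] --> f t.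

End BochnerMeasurable.

Section SimpleFunTheory.
Context d (S : measurableType d) (R : realType) (mu : {measure set S -> \bar R}).
Implicit Types X : normedModType R.

Let simple_fun_preimage X (s : S -> X) (B : set X) :
  simple_fun s -> measurable (s @^-1` B).
Proof.
move=> [fs ms].
rewrite (_ : s @^-1` B = \bigcup_(x in range s `&` B) s @^-1` [set x]).
  by apply: fin_bigcup_measurable => //; exact: finite_setIl.
apply/seteqP; split => [t Bt | t [x [_ Bx] /= ->] //].
by exists (s t) => //; split => //; exists t.
Qed.

Let simple_fun_comp X (Y : normedModType R) (h : X -> Y) (s : S -> X) :
  simple_fun s -> simple_fun (h \o s).
Proof.
move=> ss; split.
  by rewrite -(image_comp s h); apply: (@finite_image _ _ (range s)); case: ss.
by move=> x; rewrite comp_preimage; exact: simple_fun_preimage.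
Qed.

Let simple_fun_add X (s u : S -> X) :
  simple_fun s -> simple_fun u -> simple_fun (fun t => s t + u t).
Proof.
move=> ss su; split.
  apply: (@sub_finite_set _ _ [set x + y | x in range s & y in range u]).
    by move=> _ [t _ <-]; exists (s t); [exists t|exists (u t) => //; exists t].
  by apply: finite_image2; [case: ss|case: su].
move=> z; rewrite (_ : _ @^-1` _ =
    \bigcup_(x in range s) (s @^-1` [set x] `&` u @^-1` [set z - x])).
  apply: fin_bigcup_measurable; first by case: ss.
  by move=> x _; apply: measurableI; exact: simple_fun_preimage.
apply/seteqP; split => [t /= <-|t [x _ [/= -> ->]]]; last by rewrite addrC subrK.
by exists (s t); [exists t|split => //=; rewrite addrC addKr].
Qed.

Let simple_fun_norm_measurable X (s : S -> X) :
  simple_fun s -> measurable_fun setT (fun t => `|s t|).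
Proof.
move=> ss _ B mB; rewrite setTI.
exact: (@simple_fun_preimage _ s [set x | B `|x|]).
Qed.

Lemma bochner_measurable0 X : bochner_measurable mu (0 : S -> X).
Proof.
exists (fun=> 0) => [_|]; last by apply: aeW => t; exact: cvg_cst.
split; last first.
  move=> x; rewrite preimage_cst; case: ifP => _; first exact: measurableT.
  exact: measurable0.
by apply: (@sub_finite_set _ _ [set 0]) => // _ [t _ <-].
Qed.

Lemma bochner_measurableD X (f g : S -> X) : bochner_measurable mu f ->
  bochner_measurable mu g -> bochner_measurable mu (f + g).
Proof.
move=> [s ss sf] [u su ug]; exists (fun n t => s n t + u n t).
  by move=> n; exact: simple_fun_add.
by apply: filterS2 sf ug => t; exact: cvgD.
Qed.

Lemma bochner_measurableZ X (a : R) (f : S -> X) :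
  bochner_measurable mu f -> bochner_measurable mu (a *: f).
Proof.
move=> [s ss sf]; exists (fun n => ( *:%R a) \o s n).
  by move=> n; exact: simple_fun_comp.
by apply: filterS sf => t; exact: cvgZr.
Qed.

Lemma bochner_measurable_norm X (f : S -> X) : bochner_measurable mu f ->
  exists2 g : S -> R, measurable_fun setT g & g = (fun t => `|f t|) %[ae mu].
Proof.
move=> [s ss [N [mN N0 fN]]].
exists (fun t => `|f t| * \1_(~` N) t); last first.
  exists N; split=> // t /= ft; apply: contrapT => Nt; apply: ft => _.
  by rewrite indicE mem_set// mulr1.
apply: (@measurable_fun_cvg _ _ _ _ (fun n t => `|s n t| * \1_(~` N) t)).
  move=> n; apply: measurable_funM; first exact: simple_fun_norm_measurable.
  by apply: measurable_indic; exact: measurableC.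
move=> t _; rewrite indicE; have [tN|tN] := boolP (t \in ~` N).
  under eq_fun do rewrite mulr1.
  rewrite mulr1; apply: cvg_norm; apply: contrapT => sf.
  by move/set_mem: tN; apply; exact: fN.
under eq_fun do rewrite mulr0.
by rewrite mulr0; exact: cvg_cst.
Qed.

End SimpleFunTheory.

Section KotheTheory.
Context d (S : measurableType d) (R : realType) (mu : {measure set S -> \bar R})
  (E : kotheSpace mu).
Implicit Types e : E.

Lemma kfun0 : kfun (0 : E) = (fun=> 0) %[ae mu].
Proof.
have := @kfun_linear _ _ _ _ E 1 0 0; rewrite scaler0 addr0.
apply: filterS => t /= /(_ I) h _.
by apply: (@addrI _ (kfun (0 : E) t)); rewrite addr0 [in RHS]h mul1r.
Qed.

Lemma kfunD e e' : kfun (e + e') = (fun t => kfun e t + kfun e' t) %[ae mu].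
Proof.
have := @kfun_linear _ _ _ _ E 1 e e'; rewrite scale1r.
by apply: filterS => t /= h _; rewrite h// mul1r.
Qed.

Lemma kfunZ a e : kfun (a *: e) = (fun t => a * kfun e t) %[ae mu].
Proof.
have := @kfun_linear _ _ _ _ E a e 0; rewrite addr0 => h; have h0 := kfun0.
by apply: filterS2 h h0 => t /= h h0 _; rewrite h// h0// addr0.
Qed.

Lemma ler_kfun e e' : (\forall t \ae mu, `|kfun e t| <= `|kfun e' t|) ->
  `|e| <= `|e'|.
Proof.
move=> ee'; have [|h /kfun_inj -> //] := @kfun_ideal _ _ _ _ E e' (kfun e) _ ee'.
exact: measurable_funPT.
Qed.

End KotheTheory.

Section KotheBochner.
Context d (S : measurableType d) (R : realType) (mu : {measure set S -> \bar R})
  (E : kotheSpace mu) (X : normedModType R).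

(* The set of [e : E] representing t |-> `|f t|; by [kfun_inj] it has at most
   one element. *)
Definition norm_class (f : S -> X) : set E :=
  [set e : E | kfun e = (fun t => `|f t|) %[ae mu]].

Definition kothe_bochner_fun : {pred S -> X} :=
  mem [set f | bochner_measurable mu f /\ norm_class f !=set0].

Let norm_class_intro (f : S -> X) (e : E) : bochner_measurable mu f ->
  (\forall t \ae mu, `|f t| <= `|kfun e t|) -> norm_class f !=set0.
Proof.
move=> /bochner_measurable_norm[g mg gf] fe.
have [|h hg _] := @kfun_ideal _ _ _ _ E e g mg.
  by apply: filterS2 gf fe => t /= -> //; rewrite normr_id.
by exists h; apply: filterS2 hg gf => t /= -> // ->.
Qed.

Let kothe_bochner_submod_closed : submod_closed kothe_bochner_fun.
Proof.
split=> [|a f g /set_mem[mf [e fe]] /set_mem[mg [e' ge']]]; apply/mem_set.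
  split; first exact: bochner_measurable0.
  exists 0; have := kfun0 E.
  by apply: filterS => t /= h _; rewrite h// normr0.
have mfg : bochner_measurable mu (a *: f + g).
  by apply: bochner_measurableD => //; exact: bochner_measurableZ.
split=> //; apply: (@norm_class_intro _ (`|a| *: e + e')) => //.
have h := @kfun_linear _ _ _ _ E `|a| e e'.
apply: filterS3 h fe ge' => t /= -> // -> // -> //.
rewrite [leRHS]ger0_norm ?addr_ge0 ?mulr_ge0//.
by rewrite (le_trans (ler_normD _ _))// normrZ.
Qed.

HB.instance Definition _ :=
  GRing.isSubmodClosed.Build R (S -> X) kothe_bochner_fun
    kothe_bochner_submod_closed.

Definition kothe_bochner_pre := {f : S -> X | f \in kothe_bochner_fun}.

HB.instance Definition _ := SubChoice.on kothe_bochner_pre.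
HB.instance Definition _ :=
  [SubChoice_isSubLmodule of kothe_bochner_pre by <:].

Definition kothe_bochner_null : {pred kothe_bochner_pre} :=
  mem [set f : kothe_bochner_pre | val f = (fun=> 0) %[ae mu]].

Let kothe_bochner_null_closed : submod_closed kothe_bochner_null.
Proof.
split=> [|a f g /set_mem f0 /set_mem g0]; apply/mem_set.
  by apply: aeW.
apply: filterS2 f0 g0 => t f0 g0 _.
by rewrite [LHS](_ : _ = a *: val f t + val g t)// f0// g0// scaler0 addr0.
Qed.

HB.instance Definition _ :=
  GRing.isSubmodClosed.Build R kothe_bochner_pre kothe_bochner_null
    kothe_bochner_null_closed.

(* Quotient of the space of functions by the subspace of those vanishing a.e. *)
Definition kotheBochner : Type := Quotient.quot kothe_bochner_null.

HB.instance Definition _ := GRing.Zmodule.on kotheBochner.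

Definition kotheBochner_class (f : kothe_bochner_pre) : kotheBochner :=
  (\pi_(Quotient.quot kothe_bochner_null) f)%qT.
Local Notation pi := kotheBochner_class.

Let piK (q : kotheBochner) : pi (repr q) = q.
Proof. exact: reprK. Qed.

Lemma kothe_bochner_eqP (f g : kothe_bochner_pre) :
  pi f = pi g <-> val f = val g %[ae mu].
Proof.
have -> : (pi f = pi g) <-> (f - g \in kothe_bochner_null).
  by rewrite Quotient.idealrBE; split => [/eqP|/eqP].
split => [/set_mem|fg].
  apply: filterS => t h _; apply/eqP; rewrite -subr_eq0; apply/eqP.
  by rewrite -[RHS](h I).
apply/mem_set; apply: filterS fg => t h _.
by rewrite [LHS](_ : _ = val f t - val g t)// h// subrr.
Qed.

Let kb_scale (a : R) (q : kotheBochner) : kotheBochner := pi (a *: repr q).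

Let kb_scale_pi a f : kb_scale a (pi f) = pi (a *: f).
Proof.
apply/kothe_bochner_eqP; have := (kothe_bochner_eqP (repr (pi f)) f).1 (piK _).
apply: filterS => t h _.
rewrite [LHS](_ : _ = a *: val (repr (pi f)) t)// h//.
Qed.

Let kb_addE (f g : kothe_bochner_pre) : pi f + pi g = pi (f + g).
Proof. exact/esym/Quotient.pi_add. Qed.

Let kb_scaleA a b q : kb_scale a (kb_scale b q) = kb_scale (a * b) q.
Proof. by rewrite -[q]piK !kb_scale_pi scalerA. Qed.

Let kb_scale1 : left_id 1 kb_scale.
Proof. by move=> q; rewrite -[q]piK kb_scale_pi scale1r. Qed.

Let kb_scaleDr : right_distributive kb_scale +%R.
Proof.
move=> a p q; rewrite -[p]piK -[q]piK.
by rewrite kb_addE !kb_scale_pi kb_addE scalerDr.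
Qed.

Let kb_scaleDl q : {morph kb_scale^~ q : a b / a + b}.
Proof. by move=> a b; rewrite -[q]piK !kb_scale_pi kb_addE scalerDl. Qed.

HB.instance Definition _ := GRing.Zmodule_isLmodule.Build R kotheBochner
  kb_scaleA kb_scale1 kb_scaleDr kb_scaleDl.

Definition kothe_bochner_norm (f : S -> X) : R := `|xget 0 (norm_class f)|.

Let norm_classP (f : kothe_bochner_pre) :
  norm_class (val f) (xget 0 (norm_class (val f))).
Proof. by have /set_mem[_ [e fe]] := valP f; exact: xgetI fe. Qed.

Lemma kothe_bochner_normE (f : S -> X) (e : E) :
  norm_class f e -> kothe_bochner_norm f = `|e|.
Proof.
move=> fe; congr (`|_|); apply: kfun_inj.
have h := xgetI 0 fe; apply: filterS2 h fe => t /= h fe _.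
by rewrite h// fe.
Qed.

Let kb_norm (q : kotheBochner) : R := kothe_bochner_norm (val (repr q)).

Let kb_norm_pi (f : kothe_bochner_pre) : kb_norm (pi f) = kothe_bochner_norm (val f).
Proof.
apply: kothe_bochner_normE.
have := (kothe_bochner_eqP (repr (pi f)) f).1 (piK _).
by apply: filterS2 (norm_classP f) => t /= -> // ->.
Qed.

Let kb_normD p q : kb_norm (p + q) <= kb_norm p + kb_norm q.
Proof.
rewrite -[p]piK -[q]piK kb_addE !kb_norm_pi.
move: (repr p) (repr q) => f g.
apply: le_trans (ler_normD _ _); apply: ler_kfun.
have hD := kfunD (xget 0 (norm_class (val f))) (xget 0 (norm_class (val g))).
have hfg := norm_classP (f + g).
apply: filterS (filterI hD (filterI hfg (filterI (norm_classP f) (norm_classP g)))).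
move=> t [/= -> // [-> // [-> // -> //]]].
by rewrite normr_id [leRHS]ger0_norm ?addr_ge0//; exact: ler_normD.
Qed.

Let kb_normZ a q : kb_norm (a *: q) = `|a| * kb_norm q.
Proof.
rewrite -[q]piK [a *: _]kb_scale_pi !kb_norm_pi; move: (repr q) => f.
rewrite -[`|a|]normr_id -normrZ; apply: kothe_bochner_normE.
apply: filterS2 (kfunZ `|a| (xget 0 (norm_class (val f)))) (norm_classP f).
by move=> t /= -> // -> // _; rewrite -normrZ.
Qed.

Let kb_norm0_eq0 q : kb_norm q = 0 -> q = 0.
Proof.
rewrite -[q]piK kb_norm_pi; move: (repr q) => f /normr0_eq0 f0.
rewrite -[0](piK 0); apply/kothe_bochner_eqP.
have r0 : val (repr (0 : kotheBochner)) = val (0 : kothe_bochner_pre) %[ae mu].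
  by apply/kothe_bochner_eqP; rewrite piK; exact/esym/pi_zeror.
have := norm_classP f; rewrite f0 /norm_class/= => h.
apply: filterS3 r0 h (kfun0 E) => t r0 h k0 _.
by rewrite r0//; apply: normr0_eq0; rewrite -h// k0.
Qed.

HB.instance Definition _ := Lmodule_isNormed.Build R kotheBochner
  kb_normD kb_normZ kb_norm0_eq0.

Lemma kotheBochner_classK (q : kotheBochner) : kotheBochner_class (repr q) = q.
Proof. exact: piK. Qed.

Lemma kotheBochner_classP a (f g : kothe_bochner_pre) :
  kotheBochner_class (a *: f + g) =
  a *: kotheBochner_class f + kotheBochner_class g.
Proof. by rewrite -kb_addE; congr (_ + _); exact/esym/kb_scale_pi. Qed.

Lemma kotheBochner_normE (f : kothe_bochner_pre) (e : E) :
  norm_class (val f) e -> `|kotheBochner_class f| = `|e|.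
Proof. by rewrite -[LHS]/(kb_norm _) kb_norm_pi; exact: kothe_bochner_normE. Qed.

End KotheBochner.

(* Main.v *)
From HB Require Import structures.
Require Import Defs.
From mathcomp Require Import all_boot all_order all_algebra.
From mathcomp Require Import all_classical all_reals all_analysis.
From mathcomp Require Import measurable_realfun ring lra.

Set Implicit Arguments.
Unset Strict Implicit.
Unset Printing Implicit Defensive.

Import Order.TTheory GRing.Theory Num.Theory.
Import numFieldNormedType.Exports.

Local Open Scope classical_set_scope.
Local Open Scope ring_scope.

(** Describing the dual of E(X) is avoided by a reformulation of uacs that
    speaks of norms only ([alternative_descent]): for every e > 0 there are
    d, t > 0 such that unit vectors x, y with |x + y| >= 2 - d satisfy
    |x - t y| <= 1 - (1 - e) t.  In other words, when x and y are almost
    aligned, moving from x in the direction -y decreases the norm at almost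
    unit speed.  This gives uacs by applying the functionals to x - t y;
    conversely, a functional norming x - t y is almost norming at x, and
    uacs then bounds its value at y from below.  The second direction rests on
    the Hahn-Banach theorem, proved first.

    Now let f, g be unit vectors of E(X) with |f + g| close to 2, and put
    a = |f(.)|, b = |g(.)|, c = |f(.) + g(.)|, unit vectors a, b of E and
    c <= a + b with |c| close to 2.  Let phi be a norm-one functional on E with
    phi(a) = 1; as E is uniformly smooth, |a + h| is 1 + phi(h) up to
    an error that is o(|h|) uniformly in a
    ([US_uniform_differentiability]).  Scaling the inequality
    for X ([alternative_descent_trichotomy]) shows that at almost every point
    either |f - t g| <= a - (1 - e) t b, or the point lies in one of two bad
    sets: D1, where c <= a + b - delta b, and D2, where a <= kappa b.
    Everywhere |f - t g| <= a + t b, so writing u1, u2 for the restrictions of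
    b to D1, D2,
      |f - t g| <= a - (1 - e) t b + 2 t u1 + 2 t u2   almost everywhere.
    By uniform differentiability it remains to see that phi(b) is almost 1
    and that phi(u1), phi(u2) are at most small.

    - D1: c <= a + b - delta u1, hence both a + b and a + (b - delta u1) have
      norm close to 2, which forces phi(b) and phi(b - delta u1) to be close
      to 1 ([US_aligned]); the difference bounds delta phi(u1).
    - D2: where u2 lives a is negligible, so |a + s u2| and |a - s u2| are
      almost the same function and have almost the same norm; by smoothness
      these norms are 1 + s phi(u2) and 1 - s phi(u2) up to a small error
      ([US_norming_small_on_support]).

    The constants are chosen in the order kappa (from E), then delta (from X
    and kappa), then the bound on 2 - |f + g| (from E and delta). *)

(** * The Hahn-Banach theorem *)

Section HahnBanach.
Context {R : realType} {V : lmodType R}.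
Implicit Types (p q : V -> R) (x y : V).

Definition sublinear p :=
  (forall x y, p (x + y) <= p x + p y) /\
  (forall (c : R) x, 0 < c -> p (c *: x) <= c * p x).

Lemma sublinear0 p : sublinear p -> p 0 = 0.
Proof.
move=> [pD pZ]; have := pD 0 0; have := pZ 2^-1 0.
by rewrite addr0 scaler0 invr_gt0 ltr0n => /(_ isT); lra.
Qed.

Lemma sublinearZ p (c : R) x : sublinear p -> 0 <= c -> p (c *: x) = c * p x.
Proof.
move=> sp; rewrite le_eqVlt => /predU1P[<-|c0].
  by rewrite scale0r sublinear0// mul0r.
apply/eqP; rewrite eq_le (sp.2 _ _ c0)/= -ler_pdivlMl//.
by have := sp.2 c^-1 (c *: x); rewrite scalerK ?gt_eqF// invr_gt0 => ->.
Qed.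

Lemma sublinear_oppr p x : sublinear p -> - p (- x) <= p x.
Proof. by move=> sp; have := sp.1 x (- x); rewrite subrr sublinear0//; lra. Qed.

(** The chain condition makes any two members of the family comparable, so one
    of them can serve both summands; this is what keeps the infimum
    subadditive.  The common bound [p0] keeps the infimum finite. *)
Lemma sublinear_chain_inf (F : set (V -> R)) (p0 : V -> R) :
  F !=set0 -> sublinear p0 ->
  (forall p, F p -> sublinear p /\ forall x, p x <= p0 x) ->
  (forall p q, F p -> F q ->
    (forall x, p x <= q x) \/ (forall x, q x <= p x)) ->
  exists2 q, sublinear q & forall p, F p -> forall x, q x <= p x.
Proof.
move=> F0 sp0 Fp Ftot; pose G x := [set p x | p in F].
have G0 x : G x !=set0 by case: F0 => p ?; exists (p x), p.
have lbG x : lbound (G x) (- p0 (- x)).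
  move=> _ [p /Fp[sp pp0] <-]; apply: le_trans (sublinear_oppr _ sp).
  by rewrite lerN2.
have qle p : F p -> forall x, inf (G x) <= p x.
  by move=> ? x; apply: ge_inf; [exists (- p0 (- x))|exists p].
exists (fun x => inf (G x)) => //; split=> [x y|c x c0].
  rewrite -lerBlDr; apply: lb_le_inf => [//|_ [p1 Fp1 <-]].
  rewrite lerBlDr [leRHS]addrC -lerBlDr; apply: lb_le_inf => [//|_ [p2 Fp2 <-]].
  rewrite lerBlDr; have [le12|le21] := Ftot _ _ Fp1 Fp2.
    have := qle _ Fp1 (x + y); have := (Fp _ Fp1).1.1 x y; have := le12 y; lra.
  have := qle _ Fp2 (x + y); have := (Fp _ Fp2).1.1 x y; have := le21 x; lra.
rewrite -ler_pdivrMl//; apply: lb_le_inf => [//|_ [p Ff <-]].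
rewrite ler_pdivrMl//; apply: le_trans ((Fp _ Ff).1.2 _ _ c0); exact: qle.
Qed.

(** The infimum of [p (x + t *: y) - t * p y] over [t >= 0]: it is the largest
    sublinear functional below [p] that takes the value [- p y] at [- y], hence
    is linear along the line through [y].  It is used twice, to see that
    minimal sublinear functionals are additive and to make the functional of
    the Hahn-Banach theorem attain a prescribed value. *)
Lemma sublinear_tilt p y : sublinear p ->
  exists2 q, sublinear q &
    forall x, q x <= p x /\ q x <= p (x + y) - p y.
Proof.
move=> sp.
pose G x := [set p (x + t *: y) - t * p y | t in [set t : R | 0 <= t]].
have Gne x : G x !=set0 by exists (p (x + 0 *: y) - 0 * p y), 0 => //=.
have lbG x : lbound (G x) (- p (- x)).
  move=> _ [t /= t0 <-]; rewrite -(sublinearZ _ sp t0).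
  by have := sp.1 (x + t *: y) (- x); rewrite addrAC subrr add0r; lra.
have qle x t : 0 <= t -> inf (G x) <= p (x + t *: y) - t * p y.
  by move=> t0; apply: ge_inf; [exists (- p (- x))|exists t].
exists (fun x => inf (G x)).
  split=> [x x'|c x c0].
    rewrite -lerBlDr; apply: lb_le_inf => [//|_ [t /= t0 <-]].
    rewrite lerBlDr [leRHS]addrC -lerBlDr.
    apply: lb_le_inf => [//|_ [t' /= t'0 <-]].
    have := qle (x + x') (t + t') (addr_ge0 t0 t'0).
    have := sp.1 (x + t *: y) (x' + t' *: y).
    by rewrite scalerDl addrACA; lra.
  rewrite -ler_pdivrMl//; apply: lb_le_inf => [//|_ [t /= t0 <-]].
  rewrite ler_pdivrMl//; apply: le_trans (qle _ (c * t) _) _.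
    by rewrite mulr_ge0// ltW.
  rewrite -scalerA -scalerDr mulrBr mulrA lerD2r; exact: sp.2.
move=> x; split.
  by have := qle x 0 (lexx 0); rewrite scale0r addr0 mul0r subr0.
by have := qle x 1 ler01; rewrite scale1r mul1r.
Qed.

(** By Zorn's lemma there is a minimal sublinear functional [f] below [p].
    Tilting [f] along [y] cannot decrease it, and comparison at [t = 1] then
    reads [f x + f y <= f (x + y)]; so [f] is additive, hence linear. *)
Theorem hahn_banach p : sublinear p ->
  exists phi : {linear V -> R^o}, forall x, (phi x : R) <= p x.
Proof.
move=> sp; pose T := {q : V -> R | sublinear q /\ forall x, q x <= p x}.
pose le (q r : T) := `[< forall x, sval r x <= sval q x >].
pose t0 : T := exist _ p (conj sp (fun x => lexx (p x))).
have [] := @ZL_preorder T t0 le.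
- by move=> q; apply/asboolP.
- move=> q r s /asboolP qr /asboolP rs; apply/asboolP => x.
  exact: le_trans (rs x) (qr x).
- move=> A Atot; have [[r Ar]|A0] := pselect (A !=set0); last first.
    by exists t0 => s As; exfalso; apply: A0; exists s.
  have [||||q sq qA] := @sublinear_chain_inf [set sval r | r in A] p.
  + by exists (sval r), r.
  + exact: sp.
  + by move=> _ [s As <-]; exact: proj2_sig s.
  + move=> _ _ [s As <-] [s' As' <-].
    by have [/asboolP|/asboolP] := Atot _ _ As As'; [right|left].
  have qp x : q x <= p x.
    have qr : q x <= sval r x by apply: qA; exists r.
    exact: le_trans qr ((proj2_sig r).2 x).
  exists (exist _ q (conj sq qp)) => s As; apply/asboolP => x /=.
  by apply: qA; exists s.
move=> [f [sf fp]] fmin.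
have fD x y : f (x + y) = f x + f y.
  apply/eqP; rewrite eq_le sf.1/=; have [q sq qf] := sublinear_tilt y sf.
  have qp z : q z <= p z by apply: le_trans (fp z); exact: (qf z).1.
  have fq : le (exist _ f (conj sf fp)) (exist _ q (conj sq qp)).
    by apply/asboolP => z; exact: (qf z).1.
  by have /asboolP/(_ x)/= := fmin _ fq; have := (qf x).2; lra.
have fN x : f (- x) = - f x.
  by have := fD x (- x); rewrite subrr sublinear0//; lra.
have fZ (c : R) x : f (c *: x) = c * f x.
  have [c0|c0] := leP 0 c; first exact: sublinearZ.
  rewrite -[in LHS](opprK c) scaleNr fN sublinearZ ?oppr_ge0 ?ltW//.
  by rewrite mulNr opprK.
have flin : linear (f : V -> R^o) by move=> c x y; rewrite fD fZ.
pose phi : {linear V -> R^o} := HB.pack (f : V -> R^o)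
  (GRing.isLinear.Build R V R^o _ (f : V -> R^o) flin).
by exists phi.
Qed.

End HahnBanach.

(** * Norming functionals and a description of uacs by norms *)

Section Norming.
Context (R : realType) (V : normedModType R).
Implicit Types (x y z h : V) (phi : {linear V -> R^o}).

Lemma sublinear_norm : sublinear (fun x : V => `|x|).
Proof.
by split=> [x y|c x c0]; [exact: ler_normD|rewrite normrZ gtr0_norm].
Qed.

(** Tilting the norm along [z] before applying the Hahn-Banach theorem forces
    the value at [- z] to be at most [- `|z|]. *)
Lemma norming_functional z : exists phi : {linear V -> R^o},
  (forall x, (phi x : R) <= `|x|) /\ (phi z : R) = `|z|.
Proof.
have [q sq qz] := sublinear_tilt z (sublinear_norm).
have [phi phiq] := hahn_banach sq.
have phi1 x : (phi x : R) <= `|x| by apply: le_trans (phiq x) (qz x).1.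
exists phi; split=> //; apply/eqP; rewrite eq_le phi1/=.
have := le_trans (phiq (- z)) (qz (- z)).2.
by rewrite addNr normr0 sub0r linearN lerN2.
Qed.

(** Stated with the product of [R], where [linearZ] leaves the scaling of the
    module [R^o]. *)
Lemma functionalZ phi (c : R) x : (phi (c *: x) : R) = c * (phi x : R).
Proof. by rewrite linearZ. Qed.

Lemma dominated_abs phi x :
  (forall y, (phi y : R) <= `|y|) -> `|phi x : R| <= `|x|.
Proof.
move=> phi1; rewrite ler_norml phi1 andbT lerNl.
by have := phi1 (- x); rewrite linearN normrN.
Qed.

Lemma dual_unit_sphere_norming phi z : z != 0 ->
  (forall x, (phi x : R) <= `|x|) -> (phi z : R) = `|z| ->
  dual_unit_sphere phi.
Proof.
move=> z0 phi1 phiz; have z1 : 0 < `|z| by rewrite normr_gt0.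
split.
  apply: bounded_linear_continuous; apply/bounded_funP => r; exists r => x xr.
  exact: le_trans (dominated_abs x phi1) xr.
rewrite /dual_norm; apply/eqP; rewrite eq_le; apply/andP; split.
  apply: ge_sup; first by exists `|phi 0|, 0 => //; rewrite /unit_ball/= normr0.
  by move=> _ [x x1 <-]; apply: le_trans (dominated_abs x phi1) x1.
apply: ub_le_sup.
  by exists 1 => _ [x x1 <-]; apply: le_trans (dominated_abs x phi1) x1.
exists (`|z|^-1 *: z).
  by rewrite /unit_ball/= normrZ normfV normr_id mulVf// gt_eqF.
by rewrite linearZ/= [phi z]phiz -[_ *: _]/(_ * _) mulVf ?gt_eqF// normr1.
Qed.

(** The supremum defining [dual_norm] is 0 by convention when it is not finite,
    so a dual norm equal to 1 guarantees that the supremum is genuine. *)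
Lemma dual_unit_sphere_le phi x : dual_unit_sphere phi -> (phi x : R) <= `|x|.
Proof.
move=> [_ phi1].
have [hs|/sup_out hs] :=
  pselect (has_sup [set `|phi x| | x in @unit_ball _ V]); last first.
  by move: phi1; rewrite /dual_norm hs => /eqP; rewrite eq_sym oner_eq0.
have [->|x0] := eqVneq x 0; first by rewrite linear0 normr0.
have nx : 0 < `|x| by rewrite normr_gt0.
have : `|phi (`|x|^-1 *: x)| <= 1.
  rewrite -phi1; apply: sup_upper_bound => //; exists (`|x|^-1 *: x) => //.
  by rewrite /unit_ball/= normrZ normfV normr_id mulVf// gt_eqF.
rewrite linearZ/= -[_ *: _]/(_ * _) normrM normfV normr_id.
by rewrite ler_pdivrMl// mulr1; apply: le_trans; exact: ler_norm.
Qed.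

(** A description of uacs by norms alone.  By convexity of the norm, the
    inequality for one [t] implies it for all smaller [t]. *)
Definition alternative_descent : Prop :=
  forall e : R, 0 < e -> exists2 d : R, 0 < d & exists2 t : R, 0 < t &
    forall x y, `|x| = 1 -> `|y| = 1 -> 2 - d <= `|x + y| ->
      `|x - t *: y| <= 1 - (1 - e) * t.

(** Apply [phi n] to [x n - t *: y n]: its value is at most
    [1 - (1 - e) * t], and it is close to [1 - t * phi n (y n)]. *)
Lemma alternative_descent_uacs : alternative_descent -> uacs V.
Proof.
move=> ad x y phi x1 y1 phi1 xy phix.
apply/cvgrPdist_le => e e0.
have [d d0 [t t0 xyd]] := ad (e / 2) (divr_gt0 e0 (ltr0Sn _ _)).
have et0 : 0 < e / 2 * t by rewrite mulr_gt0// divr_gt0.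
move/cvgrPdist_le/(_ _ d0) : xy; move/cvgrPdist_le/(_ _ et0) : phix.
apply: filterS2 => n phix xy.
have {}xy : `|x n - t *: y n| <= 1 - (1 - e / 2) * t.
  by apply: xyd; [exact: x1|exact: y1|move: xy; rewrite ler_norml; lra].
have phiy := dual_unit_sphere_le (y n) (phi1 n).
have := le_trans (dual_unit_sphere_le _ (phi1 n)) xy.
rewrite linearB linearZ/= => h; move: phiy; rewrite (y1 n) => phiy.
move: h phix phiy; rewrite -[_ *: _]/(_ * _).
set a : R := phi n (x n); set b : R := phi n (y n).
change (a - t * b <= 1 - (1 - e / 2) * t -> `|1 - a| <= e / 2 * t ->
   b <= 1 -> `|1 - b| <= e).
move=> h; rewrite !ler_norml => /andP[_ ha] hb.
have : t * (1 - b) <= t * e by lra.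
by rewrite ler_pM2l// => hbe; lra.
Qed.

(** If the property fails for [e], take [d = t = r n] with [r n] tending to 0,
    a bad pair [(x, y)] for these values, and a functional [phi n] norming
    [x - r n *: y].  It nearly norms [x], so uacs sends [phi n y] to 1; but
    [r n * phi n y = phi n x - `|x - r n *: y| < r n * (1 - e)]. *)
Lemma uacs_alternative_descent : uacs V -> alternative_descent.
Proof.
move=> V_uacs e e0; apply: contrapT => nad.
(* Starting at 1/2 rather than 1 keeps [z n] below nonzero. *)
pose r (n : nat) : R := n.+2%:R^-1.
have r0 n : 0 < r n by rewrite invr_gt0.
have rlt n : r n < 1 by rewrite invf_lt1// ltr1n.
have bad n : exists xy : V * V, [/\ `|xy.1| = 1, `|xy.2| = 1,
    2 - r n <= `|xy.1 + xy.2| & 1 - (1 - e) * r n < `|xy.1 - r n *: xy.2| ].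
  apply: contrapT => nxy; apply: nad.
  exists (r n) => //; exists (r n) => // x y x1 y1 xy; rewrite leNgt.
  by apply/negP => xyr; apply: nxy; exists (x, y).
have [xy {}bad] := choice bad.
pose z n := (xy n).1 - r n *: (xy n).2.
have [phi phiP] := choice (fun n => norming_functional (z n)).
have zlt n : 1 - r n <= `|z n|.
  have [x1 y1 _ _] := bad n; apply: le_trans (lerB_dist _ _).
  by rewrite normrZ x1 y1 mulr1 gtr0_norm.
have z0 n : z n != 0.
  by rewrite -normr_gt0; apply: lt_le_trans (zlt n); rewrite subr_gt0.
have phiz n : `|z n| = (phi n (xy n).1 : R) - r n * (phi n (xy n).2 : R).
  by rewrite -(phiP n).2 linearB linearZ.
have phile n v : (phi n v : R) <= `|v| by exact: (phiP n).1.
have rcvg : r n @[n --> \oo] --> (0 : R).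
  rewrite -[X in X @ _]/(fun n => harmonic n.+1).
  by rewrite (cvg_shiftS (@harmonic R)); exact: cvg_harmonic.
have phi_y : (phi n (xy n).2 : R) @[n --> \oo] --> (1 : R).
  apply: (V_uacs (fun n => (xy n).1) (fun n => (xy n).2) phi).
  - by move=> n; case: (bad n).
  - by move=> n; case: (bad n).
  - by move=> n; apply: dual_unit_sphere_norming (z0 n) (phile n) (phiP n).2.
  - apply/cvgrPdist_le => c c0.
    move/cvgrPdist_le/(_ _ c0) : rcvg; apply: filterS => n.
    rewrite sub0r normrN gtr0_norm// => rc; have [x1 y1 xyr _] := bad n.
    have := ler_normD (xy n).1 (xy n).2; rewrite x1 y1 => xy2.
    by rewrite ler_norml; lra.
  - apply/cvgrPdist_le => c c0.
    have c20 : 0 < c / 2 by rewrite divr_gt0.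
    move/cvgrPdist_le/(_ _ c20) : rcvg; apply: filterS => n.
    rewrite sub0r normrN gtr0_norm// => rc; have [x1 y1 _ _] := bad n.
    have := phile n (xy n).1; rewrite x1 => p1.
    have := phile n (- (xy n).2); rewrite linearN normrN y1 => p2.
    have {}p2 : r n * - (phi n (xy n).2 : R) <= r n by rewrite ger_pMr.
    have := phiz n; have := zlt n.
    move: p1 p2; move: (phi n _ : R) (phi n _ : R) => a b.
    by rewrite ler_norml; lra.
move: phi_y => /cvgrPdist_lt/(_ _ e0)/= [N _ /(_ N (leqnn N))]; apply/negP.
rewrite -leNgt; have [x1 y1 _ xyz] := bad N.
have := phile N (xy N).1; rewrite x1 => p1.
have := phile N (xy N).2; rewrite y1 => p2.
have := phiz N; rewrite {1}/z; move: xyz p1 p2.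
move: (phi N _ : R) (phi N _ : R) => b a xyz p1 p2 phiz'.
have : r N * b < r N * (1 - e) by lra.
rewrite ltr_pM2l// => b1; rewrite ger0_norm; lra.
Qed.

End Norming.

(** * Uniform smoothness and scaling *)

Section UniformSmoothness.
Context (R : realType) (V : normedModType R).
Implicit Types (a h x y : V) (phi : {linear V -> R^o}).

(** The modulus of smoothness bounds [`|x + y| + `|x - y|] for [y] of norm
    [tau]; its defining set is bounded by [tau], so the supremum is genuine. *)
Lemma US_norm_sum (eta : R) : US V -> 0 < eta ->
  exists2 s : R, 0 < s & forall x y, `|x| = 1 -> `|y| <= s ->
    `|x + y| + `|x - y| <= 2 + eta * `|y|.
Proof.
move=> V_US eta0.
have eta20 : 0 < eta / 2 by rewrite divr_gt0.
move/cvgrPdist_le/(_ _ eta20) : V_US => [s /= s0 small].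
exists (s / 2); first by rewrite divr_gt0.
move=> x y x1 ys; have [->|y0] := eqVneq y 0.
  by rewrite addr0 subr0 normr0 mulr0 x1; lra.
have ny : 0 < `|y| by rewrite normr_gt0.
have /small/(_ ny) : ball_ Num.norm (0 : R) s `|y|.
  by rewrite /= sub0r normrN normr_id; lra.
rewrite sub0r normrN => /(le_trans (ler_norm _)).
rewrite ler_pdivrMr// => rho.
have : 2^-1 * (`|x + y| + `|x - y| - 2) <= modulus_of_smoothness V `|y|.
  apply: ub_le_sup.
    exists `|y| => _ [u u1 [v v1 <-]].
    have := ler_normD u (`|y| *: v); have := ler_normB u (`|y| *: v).
    by rewrite normrZ normr_id (u1 : `|u| = 1) (v1 : `|v| = 1); lra.
  exists x => //; exists (`|y|^-1 *: y).
    by rewrite /unit_sphere/= normrZ normfV normr_id mulVf ?gt_eqF.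
  by rewrite scalerA divff ?gt_eqF// scale1r.
lra.
Qed.

(** Since [`|a - h| >= phi (a - h) = 1 - phi h], the bound on the sum
    [`|a + h| + `|a - h|] leaves only [1 + phi h + eta * `|h|] for the
    first term. *)
Lemma US_uniform_differentiability (eta : R) : US V -> 0 < eta ->
  exists2 s : R, 0 < s & forall a phi, `|a| = 1 ->
    (forall x, (phi x : R) <= `|x|) -> (phi a : R) = 1 ->
    forall h, `|h| <= s -> `|a + h| <= 1 + (phi h : R) + eta * `|h|.
Proof.
move=> V_US /(US_norm_sum V_US)[s s0 smooth].
exists s => // a phi a1 phi1 phia h hs.
have := smooth _ _ a1 hs; have : 1 - (phi h : R) <= `|a - h|.
  by apply: le_trans (phi1 (a - h)); rewrite linearB phia.
move: (phi h : R) => b; lra.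
Qed.

(** Going from [a] to [a + w] the norm grows by almost 1.  The last part
    [(1 - s) *: w] of the way contributes at most [1 - s], so the first part
    [s *: w] must contribute almost [s]; for small [s] that contribution is
    [s * phi w] up to a small error. *)
Lemma US_aligned (eta : R) : US V -> 0 < eta ->
  exists2 d : R, 0 < d & forall a w phi, `|a| = 1 -> `|w| <= 1 ->
    (forall x, (phi x : R) <= `|x|) -> (phi a : R) = 1 ->
    2 - d <= `|a + w| -> 1 - eta <= (phi w : R).
Proof.
move=> V_US eta0; have eta20 : 0 < eta / 2 by rewrite divr_gt0.
have [s0 s00 diff] := US_uniform_differentiability V_US eta20.
pose s := Num.min 1 s0.
have s_gt0 : 0 < s by rewrite lt_min ltr01.
have s1 : s <= 1 by rewrite ge_min lexx.
have ss0 : s <= s0 by rewrite ge_min lexx orbT.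
exists (eta / 2 * s); first exact: mulr_gt0.
move=> a w phi a1 w1 phi1 phia aw.
have nsw : `|s *: w| <= s by rewrite normrZ gtr0_norm// ger_pMr.
have := diff a phi a1 phi1 phia _ (le_trans nsw ss0).
rewrite functionalZ => asw.
have : `|a + w| <= `|a + s *: w| + (1 - s).
  have -> : a + w = (a + s *: w) + (1 - s) *: w.
    by rewrite scalerBl scale1r -addrA subrKC.
  apply: le_trans (ler_normD _ _) _.
  rewrite lerD2l normrZ ger0_norm ?subr_ge0//.
  by rewrite ler_piMr ?subr_ge0.
have : eta / 2 * `|s *: w| <= eta / 2 * s by rewrite ler_pM2l.
move: asw aw; move: (phi w : R) => b *.
have : s * (1 - eta) <= s * b by lra.
by rewrite ler_pM2l.
Qed.

(** The defining inequality of [alternative_descent] after scaling.  If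
    [`|x| > kappa * `|y|], then for small [t] the vector [x - t *: y] is
    [`|x|] times a point of the segment from the unit vector [u] of [x] to
    [u - t1 *: v], with [v] the unit vector of [y], so convexity applies when
    [u] and [v] are aligned.  When they are not, [x + y] contains
    [u + v] with coefficient [Num.min `|x| `|y|], which costs a fixed
    proportion of [`|y|]. *)
Lemma alternative_descent_trichotomy (e kappa : R) :
  alternative_descent V -> 0 < e -> 0 < kappa ->
  exists2 d : R, 0 < d <= 1 & exists2 t0 : R, 0 < t0 &
    forall t, 0 < t -> t <= t0 -> forall x y,
    [\/ `|x - t *: y| <= `|x| - (1 - e) * t * `|y|,
        `|x + y| <= `|x| + `|y| - d * `|y| | `|x| <= kappa * `|y| ].
Proof.
move=> ad e0 k0; have [d d0 [t1 t10 xyd]] := ad _ e0.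
pose m := Num.min 1 kappa.
have m0 : 0 < m by rewrite lt_min ltr01.
have d10 : 0 < Num.min 1 d by rewrite lt_min ltr01.
exists (Num.min 1 d * m).
  by rewrite mulr_gt0//= mulr_ile1 ?(ltW m0) ?(ltW d10)// ge_min lexx.
exists (t1 * kappa); first exact: mulr_gt0.
move=> t tt0 tt x y; have [xk|kx] := leP `|x| (kappa * `|y|).
  by constructor 3.
have [->|y0] := eqVneq y 0.
  by constructor 1; rewrite scaler0 normr0 subr0 mulr0 subr0.
have ny : 0 < `|y| by rewrite normr_gt0.
have nx : 0 < `|x| by apply: lt_trans kx; exact: mulr_gt0.
set u := `|x|^-1 *: x; set v := `|y|^-1 *: y.
have u1 : `|u| = 1 by rewrite normrZ normfV normr_id mulVf ?gt_eqF.
have v1 : `|v| = 1 by rewrite normrZ normfV normr_id mulVf ?gt_eqF.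
have xu : x = `|x| *: u by rewrite scalerA divff ?gt_eqF// scale1r.
have yv : y = `|y| *: v by rewrite scalerA divff ?gt_eqF// scale1r.
clearbody u v.
have [uv|uv] := leP (2 - d) `|u + v|.
  constructor 1; have {}uv := xyd _ _ u1 v1 uv.
  (* The position of [x - t *: y] on the segment. *)
  pose r := t * `|y| / (t1 * `|x|).
  have r0 : 0 <= r by rewrite divr_ge0 ?mulr_ge0// ltW.
  have r1 : r <= 1.
    rewrite ler_pdivrMr ?mulr_gt0// mul1r.
    apply: (@le_trans _ _ (t1 * (kappa * `|y|))); last first.
      by rewrite ler_pM2l// ltW.
    by rewrite mulrA ler_pM2r.
  have rt : `|x| * (r * t1) = t * `|y|.
    by rewrite /r; field; rewrite !gt_eqF.
  clearbody r.
  have -> : x - t *: y = ((1 - r) * `|x|) *: u + (r * `|x|) *: (u - t1 *: v).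
    rewrite {1}xu {1}yv scalerBr addrA -scalerDl !scalerA -rt.
    by congr (_ *: _ - _ *: _); ring.
  apply: le_trans (ler_normD _ _) _.
  rewrite !normrZ u1 !ger0_norm ?mulr_ge0 ?subr_ge0//.
  have : r * `|x| * `|u - t1 *: v| <= r * `|x| * (1 - (1 - e) * t1).
    by rewrite ler_wpM2l// mulr_ge0.
  have : (1 - e) * (`|x| * (r * t1)) = (1 - e) * (t * `|y|) by rewrite rt.
  lra.
constructor 2.
have my : m * `|y| <= Num.min `|x| `|y|.
  rewrite le_min; apply/andP; split.
    by apply: le_trans (ltW kx); rewrite ler_pM2r// ge_min lexx orbT.
  by rewrite ger_pMl// ge_min lexx.
suff : `|x + y| <= `|x| + `|y| - d * Num.min `|x| `|y|.
  have : Num.min 1 d * (m * `|y|) <= d * Num.min `|x| `|y|.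
    apply: ler_pM => //; rewrite ?(ltW d10) ?mulr_ge0 ?(ltW m0)//.
    by rewrite ge_min lexx orbT.
  lra.
have [xy|yx] := leP `|x| `|y|.
  have -> : x + y = `|x| *: (u + v) + (`|y| - `|x|) *: v.
    by rewrite {1}xu {1}yv scalerDr -addrA -scalerDl; congr (_ + _ *: _); ring.
  apply: le_trans (ler_normD _ _) _.
  rewrite !normrZ v1 normr_id [ `| _ - _|]ger0_norm ?subr_ge0//.
  have : `|x| * `|u + v| <= `|x| * (2 - d) by rewrite ler_pM2l// ltW.
  lra.
have -> : x + y = `|y| *: (u + v) + (`|x| - `|y|) *: u.
  by rewrite {1}xu {1}yv scalerDr addrAC -scalerDl; congr (_ *: _ + _); ring.
apply: le_trans (ler_normD _ _) _.
rewrite !normrZ u1 normr_id [ `| _ - _|]ger0_norm ?subr_ge0 ?(ltW yx)//.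
have : `|y| * `|u + v| <= `|y| * (2 - d) by rewrite ler_pM2l// ltW.
lra.
Qed.

End UniformSmoothness.

(** * Lattice estimates in a Koethe space *)

Section KotheLattice.
Context {d : measure_display} {S : measurableType d} {R : realType}.
Context {mu : {measure set S -> \bar R}} {E : kotheSpace mu}.
Implicit Types (a b u : E).

Lemma ler_kfunD u a b :
  (\forall t \ae mu, `|kfun u t| <= `|kfun a t| + `|kfun b t|) ->
  `|u| <= `|a| + `|b|.
Proof.
have abs (f : E) : exists2 g : E,
    kfun g = (fun t => `|kfun f t|) %[ae mu] & `|g| <= `|f|.
  apply: kfun_ideal.
    by apply: measurableT_comp => //; exact: measurable_funPT.
  by apply: aeW => t; rewrite normr_id.
move=> uab; have [a' aE a'le] := abs a; have [b' bE b'le] := abs b.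
apply: le_trans (lerD a'le b'le); apply: le_trans (ler_normD _ _).
apply: ler_kfun; apply: filterS3 (filterI uab (kfunD a' b')) aE bE.
move=> t [/= uab_t -> //] -> // -> //.
by rewrite [leRHS]ger0_norm// addr_ge0.
Qed.

Lemma measurable_ler_set (g h : S -> R) :
  measurable_fun setT g -> measurable_fun setT h ->
  measurable [set t | g t <= h t].
Proof.
move=> mg mh; have := measurable_fun_ler mg mh measurableT (Y := [set true]).
by rewrite setTI; exact.
Qed.

Lemma kfun_restrict b (D : set S) : measurable D ->
  exists u : E, kfun u = (fun t => kfun b t * \1_D t) %[ae mu].
Proof.
move=> mD.
have [||u uE _] := @kfun_ideal _ _ _ _ E b (fun t => kfun b t * \1_D t).
- by apply: measurable_funM; [exact: measurable_funPT|exact: measurable_indic].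
- apply: aeW => t; rewrite normrM ler_piMr// indicE.
  by case: (_ \in _); rewrite ?normr1 ?normr0.
- by exists u.
Qed.

(** Almost everywhere on the support of [u] the function [a] is dominated by
    [kappa * b], so the absolute values of [a + s *: u] and [a - s *: u] differ
    by at most [2 * kappa * b].  Their norms are thus almost equal, whereas
    smoothness separates them by nearly [2 * s * phi u] if [phi u] is
    positive. *)
Lemma US_norming_small_on_support (eta : R) : US E -> 0 < eta ->
  exists2 kappa : R, 0 < kappa & forall a b u (phi : {linear E -> R^o}),
    `|a| = 1 -> `|b| <= 1 -> `|u| <= 1 ->
    (forall x, (phi x : R) <= `|x|) -> (phi a : R) = 1 ->
    (\forall t \ae mu, kfun u t = 0 \/ `|kfun a t| <= kappa * `|kfun b t|) ->
    (phi u : R) <= eta.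
Proof.
move=> E_US eta0; have eta20 : 0 < eta / 2 by rewrite divr_gt0.
have [s s0 diff] := US_uniform_differentiability E_US eta20.
exists (eta / 2 * s); first exact: mulr_gt0.
move=> a b u phi a1 b1 u1 phi1 phia uab.
have : 0 < eta / 2 * s by exact: mulr_gt0.
move: uab; move kE : (eta / 2 * s) => k uab k0.
have sym : `|a + s *: u| <= `|a + (- s) *: u| + `|(2 * k) *: b|.
  apply: ler_kfunD.
  apply: filterS3 (filterI uab (kfunD a (s *: u)))
    (filterI (kfunD a ((- s) *: u)) (kfunZ s u))
    (filterI (kfunZ (- s) u) (kfunZ (2 * k) b)).
  move=> t [/= ut -> //] [-> // -> //] [-> // -> //].
  have [->|ak] := ut; first by rewrite !mulr0 lerDl.
  move: ak; move: (kfun a t) (kfun u t) (kfun b t) => A U B AB.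
  have -> : A + s * U = - (A + - s * U) + 2 * A by ring.
  apply: le_trans (ler_normD _ _) _; rewrite normrN lerD2l.
  by rewrite !normrM (gtr0_norm k0) [ `|2|]ger0_norm//; lra.
have ns : `|(- s) *: u| <= s by rewrite normrZ normrN gtr0_norm// ger_pMr.
have nk : `|(2 * k) *: b| <= 2 * k.
  by rewrite normrZ gtr0_norm ?mulr_gt0// ger_pMr ?mulr_gt0.
have := diff a phi a1 phi1 phia _ ns; have := phi1 (a + s *: u).
have : eta / 2 * `|- s *: u| <= k by rewrite -kE ler_pM2l.
rewrite linearD phia 2!functionalZ.
move: (phi u : R) => c *; rewrite -(ler_pM2l s0).
lra.
Qed.

End KotheLattice.

(** * Transfer to the Koethe-Bochner space *)

Section KotheBochnerDescent.
Context {d : measure_display} {S : measurableType d} {R : realType}.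
Context {mu : {measure set S -> \bar R}} {E : kotheSpace mu}.
Context {X : normedModType R}.
Implicit Types (f g : kotheBochner E X).

Lemma kotheBochner_norm_repr f : exists2 e : E, `|f| = `|e| &
  kfun e = (fun t => `|val (repr f) t|) %[ae mu].
Proof.
have /set_mem[_ [e fe]] := valP (repr f); exists e => //.
by rewrite -[f in LHS]kotheBochner_classK (kotheBochner_normE fe).
Qed.

(** The representative of a class chosen by the quotient is not linear in the
    class, only almost everywhere so. *)
Lemma kotheBochner_repr_linear (c : R) f g :
  val (repr (c *: f + g)) =
  (fun t => c *: val (repr f) t + val (repr g) t) %[ae mu].
Proof.
apply: (kothe_bochner_eqP (repr (c *: f + g)) (c *: repr f + repr g)).1.
by rewrite kotheBochner_classP !kotheBochner_classK.
Qed.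

(** Every estimate below is made up to [eta], and ten such errors accumulate:
    one from [phi b], two each from [phi u1] and [phi u2], which enter [h] with
    coefficient 2, and five from the error term of the differentiability,
    because [h] has norm at most 5.  Hence the choice [eta = e / 10]; together
    with the loss [e] of the pointwise inequality in [X] they make up
    [2 * e <= eps]. *)
Theorem US_kotheBochner_alternative_descent :
  US E -> alternative_descent X -> alternative_descent (kotheBochner E X).
Proof.
move=> E_US X_ad eps eps0.
(* The bound [e <= 1] serves to estimate [`|e - 1|] by 1 in the norm of [h]. *)
pose e : R := Num.min 1 (eps / 2).
have e0 : 0 < e by rewrite lt_min ltr01 divr_gt0.
have e1 : e <= 1 by rewrite ge_min lexx.
have e_eps : e <= eps / 2 by rewrite ge_min lexx orbT.
clearbody e; pose eta : R := e / 10.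
have eta0 : 0 < eta by rewrite divr_gt0.
have [kappa kappa0 small] := US_norming_small_on_support E_US eta0.
have [delta /andP[delta0 delta1] [t0 t00 tri]] :=
  alternative_descent_trichotomy X_ad e0 kappa0.
(* The factor [delta] makes up for the division by [delta] that bounds
   [phi u1]. *)
have [gap gap0 aligned] := US_aligned E_US (mulr_gt0 delta0 eta0).
have [s s0 diff] := US_uniform_differentiability E_US eta0.
exists gap => //; exists (Num.min t0 (s / 5)).
  by rewrite lt_min t00 divr_gt0.
move=> f g f1 g1 fg; set t := Num.min t0 (s / 5).
have tt0 : t <= t0 by rewrite ge_min lexx.
have ts : 5 * t <= s.
  have : t <= s / 5 by rewrite ge_min lexx orbT.
  lra.
have t_gt0 : 0 < t by rewrite lt_min t00 divr_gt0.
clearbody t.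
have [a fa aE] := kotheBochner_norm_repr f.
have [b gb bE] := kotheBochner_norm_repr g.
(* The trivial factor 1 brings [f + g] to the form [c *: f + g] in which the
   representatives are compared. *)
have [c fgc cE] := kotheBochner_norm_repr (1 *: f + g).
have [p fgp pE] := kotheBochner_norm_repr ((- t) *: g + f).
rewrite scale1r in fgc; rewrite scaleNr addrC in fgp.
have a1 : `|a| = 1 by rewrite -fa.
have b1 : `|b| = 1 by rewrite -gb.
have [phi [phi1 phia]] := norming_functional a; rewrite a1 in phia.
pose D1 := [set x | kfun c x <= kfun a x + (1 - delta) * kfun b x].
pose D2 := [set x | kfun a x <= kappa * kfun b x].
have mk (w : E) : measurable_fun setT (kfun w) by exact: measurable_funPT.
have mD1 : measurable D1.
  apply: measurable_ler_set; first exact: mk.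
  apply: measurable_funD; first exact: mk.
  by apply: measurable_funM => //; exact: mk.
have mD2 : measurable D2.
  apply: measurable_ler_set; first exact: mk.
  by apply: measurable_funM => //; exact: mk.
have [u1 u1E] := kfun_restrict b mD1.
have [u2 u2E] := kfun_restrict b mD2.
pose F x := val (repr f) x; pose G x := val (repr g) x.
have pointwise : \forall x \ae mu,
  [/\ kfun a x = `|F x|, kfun b x = `|G x|, kfun c x = `|F x + G x|,
      kfun p x = `|F x - t *: G x| &
      kfun u1 x = `|G x| * \1_D1 x /\ kfun u2 x = `|G x| * \1_D2 x].
  apply: filterS3 (filterI aE (filterI bE u1E))
    (filterI cE (filterI pE u2E))
    (filterI (kotheBochner_repr_linear 1 f g)
             (kotheBochner_repr_linear (- t) g f)).
  move=> x [/= -> // [bx ->//]] [-> // [-> // ->//]] [-> // -> //].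
  by rewrite bx// scale1r scaleNr [- _ + _]addrC.
have indic01 (D : set S) x :
    \1_D x = 0 :> R \/ (D x /\ \1_D x = 1 :> R).
  by rewrite indicE; case: (boolP (x \in D)) => [/set_mem|_]; [right|left].
have nu1 : `|u1| <= 1.
  rewrite -b1; apply: ler_kfun; apply: filterS pointwise.
  move=> x [_ -> _ _ [-> _]]; rewrite normr_id.
  by have [->|[_ ->]] := indic01 D1 x; rewrite ?mulr0 ?mulr1 ?normr0 ?normr_id.
have nu2 : `|u2| <= 1.
  rewrite -b1; apply: ler_kfun; apply: filterS pointwise.
  move=> x [_ -> _ _ [_ ->]]; rewrite normr_id.
  by have [->|[_ ->]] := indic01 D2 x; rewrite ?mulr0 ?mulr1 ?normr0 ?normr_id.
have phi_b : 1 - delta * eta <= (phi b : R).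
  apply: (aligned a) => //; first by rewrite b1.
  rewrite (le_trans fg)// fgc; apply: ler_kfun.
  apply: filterS2 pointwise (kfunD a b) => x [-> -> -> _ _] -> //.
  by rewrite normr_id [leRHS]ger0_norm ?addr_ge0// ler_normD.
pose w := (- delta) *: u1 + b.
have phi_w : 1 - delta * eta <= (phi w : R).
  apply: (aligned a) => //.
    rewrite -b1; apply: ler_kfun.
    apply: filterS2 pointwise (kfun_linear (- delta) u1 b).
    move=> x [_ bx _ _ [u1x _]] -> //; rewrite bx u1x normr_id.
    have G0 : 0 <= `|G x| by [].
    have [->|[_ ->]] := indic01 D1 x; rewrite ler_norml; first by lra.
    have : delta * `|G x| <= `|G x| by rewrite ler_piMl.
    have : 0 <= delta * `|G x| by rewrite mulr_ge0// ltW.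
    lra.
  rewrite (le_trans fg)// fgc; apply: ler_kfun.
  apply: filterS3 pointwise (kfun_linear (- delta) u1 b) (kfunD a w).
  move=> x [ax bx cx _ [u1x _]] wx -> //; rewrite wx//.
  rewrite ax bx cx u1x normr_id; apply: le_trans (ler_norm _).
  have := ler_normD (F x) (G x).
  have [->|[+ ->]] := indic01 D1 x; first by lra.
  by rewrite /D1/= ax bx cx; lra.
have phi_u1 : (phi u1 : R) <= eta.
  have := phi1 b; rewrite b1.
  have : (phi w : R) = - delta * (phi u1 : R) + (phi b : R).
    by rewrite linearD functionalZ.
  move: phi_w; move: (phi w : R) => y'.
  move: (phi u1 : R) (phi b : R) => y z *.
  have : delta * y <= delta * eta by lra.
  by rewrite ler_pM2l.
have phi_u2 : (phi u2 : R) <= eta.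
  apply: (small a b) => //; first by rewrite b1.
  apply: filterS pointwise => x [ax bx _ _ [_ ->]].
  have [->|[+ _]] := indic01 D2 x; first by left; rewrite mulr0.
  by rewrite /D2/= ax bx !normr_id; right.
(* Pointwise the norm of [f - t *: g] is at most [a + t *: h]: outside of the
   bad sets [h] is [- (1 - e) *: b], on them the coefficient of [b] in [h] is at
   least [1 + e], more than the triangle inequality needs. *)
pose h := 2 *: u1 + (2 *: u2 + (e - 1) *: b).
have nh : `|t *: h| <= 5 * t.
  rewrite normrZ gtr0_norm// mulrC ler_pM2r//.
  apply: le_trans (ler_normD _ _) _; rewrite normrZ.
  have := ler_normD (2 *: u2) ((e - 1) *: b); rewrite !normrZ b1.
  have : `|e - 1| <= 1 by rewrite ler_norml; lra.
  by rewrite [ `|2|]ger0_norm//; lra.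
have ph : `|p| <= `|a + t *: h|.
  rewrite addrC; apply: ler_kfun.
  apply: filterS3 (filterI pointwise (kfun_linear t h a))
    (filterI (kfun_linear 2 u1 (2 *: u2 + (e - 1) *: b))
             (kfun_linear 2 u2 ((e - 1) *: b))) (kfunZ (e - 1) b).
  move=> x [[ax bx cx px [u1x u2x]] -> //] [-> // -> //] -> //.
  rewrite ax bx px u1x u2x normr_id; apply: le_trans (ler_norm _).
  have tG : 0 <= t * `|G x| by rewrite mulr_ge0// ltW.
  have etG : 0 <= e * (t * `|G x|) by rewrite mulr_ge0// ltW.
  have fgt : `|F x - t *: G x| <= `|F x| + t * `|G x|.
    by apply: le_trans (ler_normB _ _) _; rewrite normrZ gtr0_norm.
  have [good|bad1|bad2] := tri t t_gt0 tt0 (F x) (G x).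
  - have [->|[_ ->]] := indic01 D1 x; have [->|[_ ->]] := indic01 D2 x; lra.
  - have -> : \1_D1 x = 1 :> R.
      by rewrite indicE mem_set// /D1/= ax bx cx; lra.
    have [->|[_ ->]] := indic01 D2 x; lra.
  - have -> : \1_D2 x = 1 :> R.
      by rewrite indicE mem_set// /D2/= ax bx.
    have [->|[_ ->]] := indic01 D1 x; lra.
have := diff a phi a1 phi1 phia _ (le_trans nh ts).
rewrite fgp => aph; apply: le_trans ph _; apply: le_trans aph _.
have : eta * `|t *: h| <= eta * (5 * t) by rewrite ler_pM2l.
have -> : (phi (t *: h) : R) =
    t * (2 * (phi u1 : R) + (2 * (phi u2 : R) + (e - 1) * (phi b : R))).
  by rewrite functionalZ 2!linearD !functionalZ.
have := phi1 b; rewrite b1; move: phi_b phi_u1 phi_u2.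
move: (phi u1 : R) (phi u2 : R) (phi b : R) => y1 y2 z zlow y1up y2up zup err.
have deltaE : delta * eta <= eta by rewrite ler_piMl// ltW.
have ez : e * z <= e by rewrite ler_piMr// ltW.
have etaE : e = 10 * eta by rewrite /eta; lra.
have : t * (2 * y1 + (2 * y2 + (e - 1) * z) + 5 * eta) <= t * (eps - 1).
  by rewrite ler_pM2l//; lra.
lra.
Qed.

End KotheBochnerDescent.

Theorem corollary3p13 (R : realType) (d : measure_display)
    (S : measurableType d) (mu : {measure set S -> \bar R})
    (mu_complete : measure_is_complete mu)
    (mu_sigma_finite : sigma_finite [set: S] mu)
    (E : kotheSpace mu) (X : completeNormedModType R) :
  US E -> uacs X -> uacs (kotheBochner E X).
Proof.
move=> E_US /uacs_alternative_descent X_ad.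
by apply: alternative_descent_uacs; exact: US_kotheBochner_alternative_descent.
Qed.
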